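(* Let $\Pi=(V_p,V_r,L,\ell_{\mathrm{init}},\ell_{\mathrm{out}},\mu_{\mathrm{init}},\mathcal D,\mathfrak T)$ be a WPTS with the bounded-update property, and fix an initial valuation $\mathbf v_{\mathrm{init}}\in\operatorname{supp}\mu_{\mathrm{init}}$. Suppose there exist reals $c_1>0$ and $c_2>c_3>0$ such that (E1) $\mathbb P_{\mathbf v_{\mathrm{init}}}(T>n)\le c_1e^{-c_2n}$ for all sufficiently large $n\in\mathbb N$, and (E2) every score function $\mathrm{wt}_j$ of every fork of $\Pi$ satisfies $|\mathrm{wt}_j(\mathbf v,\mathbf r)|\le e^{c_3}$ for all $\mathbf v,\mathbf r$. Let $h:L\times\mathbb{R}^{|V_p|}\to\mathbb{R}$ be such that $h(\ell,\cdot)$ is a polynomial in the program variables for each $\ell\in L$. If $h$ is a PUWF then $[\![\Pi]\!]_{\mathbf v_{\mathrm{init}}}(\mathbb{R}^{|V_p|})\le h(\ell_{\mathrm{init}},\mathbf v_{\mathrm{init}})$; if $h$ is a PLWF then $[\![\Pi]\!]_{\mathbf v_{\mathrm{init}}}(\mathbb{R}^{|V_p|})\ge h(\ell_{\mathrm{init}},\mathbf v_{\mathrm{init}})$.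
   Context: A weighted probabilistic transition system (WPTS) is a tuple $\Pi=(V_p,V_r,L,\ell_{\mathrm{init}},\ell_{\mathrm{out}},\mu_{\mathrm{init}},\mathcal D,\mathfrak T)$ where: $V_p$ (program variables) and $V_r$ (sampling variables) are finite disjoint sets; a program valuation is $\mathbf v\in\mathbb{R}^{|V_p|}$ and a sampling valuation is $\mathbf r\in\mathbb{R}^{|V_r|}$; $L$ is a finite set of locations with $\ell_{\mathrm{init}},\ell_{\mathrm{out}}\in L$; $\mu_{\mathrm{init}}$ is a probability distribution on $\mathbb{R}^{|V_p|}$ with bounded support; $\mathcal D$ is a product probability distribution on $\mathbb{R}^{|V_r|}$; $\mathfrak T$ is a finite set of transitions $\tau=\langle \ell,\phi,F_1,\dots,F_k\rangle$ with source location $\ell\neq\ell_{\mathrm{out}}$, guard $\phi$ (a measurable predicate on program valuations) and forks $F_j=\langle \ell'_j,p_j,\mathrm{upd}_j,\mathrm{wt}_j\rangle$, where $\ell'_j\in L$, $p_j\in(0,1]$ with $\sum_j p_j=1$, $\mathrm{upd}_j:\mathbb{R}^{|V_p|}\times\mathbb{R}^{|V_r|}\to\mathbb{R}^{|V_p|}$ measurable and $\mathrm{wt}_j:\mathbb{R}^{|V_p|}\times\mathbb{R}^{|V_r|}\to[0,\infty)$ measurable (score function). For every location $\ell\ne\ell_{\mathrm{out}}$ and valuation $\mathbf v$ there is exactly one transition with source $\ell$ whose guard $\mathbf v$ satisfies. Semantics: from a state $(\ell,\mathbf v)$ the run starts with weighted state $(\ell,\mathbf v,1)$. From $(\ell_n,\mathbf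 v_n,w_n)$: if $\ell_n=\ell_{\mathrm{out}}$ the next weighted state is the same; otherwise take the unique enabled transition, choose fork $j$ with probability $p_j$, sample $\mathbf r\sim\mathcal D$ independently, and move to $(\ell'_j,\mathrm{upd}_j(\mathbf v_n,\mathbf r),w_n\cdot\mathrm{wt}_j(\mathbf v_n,\mathbf r))$. $\mathbb P_{\mathbf v},\mathbb E_{\mathbf v}$ denote probability/expectation on runs from $(\ell_{\mathrm{init}},\mathbf v)$. $T=\min\{n:\ell_n=\ell_{\mathrm{out}}\}$; $\hat{\mathbf v}_T,\hat w_T$ are valuation and weight at termination. A state is reachable if it occurs in some run from $(\ell_{\mathrm{init}},\mathbf v_0)$ with $\mathbf v_0\in\operatorname{supp}\mu_{\mathrm{init}}$. Expected weight: $[\![\Pi]\!]_{\mathbf v}(U):=\mathbb E_{\mathbf v}[\mathbf 1_{T<\infty}[\hat{\mathbf v}_T\in U]\hat w_T]$. Bounded-update property: there is $\varkappa>0$ such that for every reachable state $(\ell,\mathbf v)$, every fork $F_j$ of the transition enabled at $(\ell,\mathbf v)$, every $\mathbf r\in\operatorname{supp}\mathcal D$ and every $x\in V_p$, $|\mathrm{upd}_j(\mathbf v,\mathbf r)(x)-\mathbf v(x)|\le\varkappa$. The expected-weight transformer: $\mathrm{ewt}(h)(\ell_{\mathrm{out}},\mathbf v)=1$ and, for $\ell\ne\ell_{\mathrm{out}}$ with enabled transition having forks $F_j=\langle\ell'_j,p_j,\mathrm{upd}_j,\mathrm{wt}_j\rangle$, $\mathrm{ewt}(h)(\ell,\mathbf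 v)=\sum_j p_j\,\mathbb E_{\mathbf r\sim\mathcal D}[\mathrm{wt}_j(\mathbf v,\mathbf r)\,h(\ell'_j,\mathrm{upd}_j(\mathbf v,\mathbf r))]$ (score functions may exceed 1 on any transition). A PUWF is $h:L\times\mathbb{R}^{|V_p|}\to\mathbb{R}$ with (C1) $\mathrm{ewt}(h)(\ell,\mathbf v)\le h(\ell,\mathbf v)$ for all reachable $(\ell,\mathbf v)$ with $\ell\neq\ell_{\mathrm{out}}$ and (C2) $h(\ell_{\mathrm{out}},\mathbf v)=1$ for all reachable $(\ell_{\mathrm{out}},\mathbf v)$. A PLWF satisfies (C2) and (C1') $\mathrm{ewt}(h)(\ell,\mathbf v)\ge h(\ell,\mathbf v)$ for all reachable $(\ell,\mathbf v)$ with $\ell\neq\ell_{\mathrm{out}}$. *)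

(* Defs.v *)
From HB Require Import structures.
From mathcomp Require Import all_boot all_order all_algebra.
From mathcomp Require Import all_classical all_reals all_analysis.
From Stdlib Require List.

Set Implicit Arguments.
Unset Strict Implicit.
Unset Printing Implicit Defensive.

Import Order.TTheory GRing.Theory Num.Theory.
Import numFieldNormedType.Exports.

Local Open Scope classical_set_scope.
Local Open Scope ring_scope.

(* np = |V_p| (program variables), nr = |V_r| (sampling variables).         *)
(* A program valuation is an np-tuple of reals, a sampling valuation an     *)
(* nr-tuple of reals (tuples carry the product = Borel sigma-algebra).      *)

Section WPTS.
Context (R : realType) (np nr : nat) (L : finType).

Notation PV := (np.-tuple R).
Notation SV := (nr.-tuple R).

Record fork := Fork {
  f_tgt : L;
  f_prob : R;
  f_upd : PV -> SV -> PV;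
  f_wt : PV -> SV -> R }.

Record transition := Transition {
  t_src : L;
  t_guard : set PV;
  t_forks : seq fork }.

Record wpts := WPTS {
  l_init : L;
  l_out : L;
  mu_init : probability PV R;
  distD : probability SV R;
  trans : seq transition }.

Definition sup_ball (m : nat) (v : m.-tuple R) (e : R) : set (m.-tuple R) :=
  [set w | forall i, `|tnth w i - tnth v i| < e].

Definition supp (m : nat) (mu : set (m.-tuple R) -> \bar R) : set (m.-tuple R) :=
  [set v | forall e : R, 0 < e -> (0 < mu (sup_ball v e))%E].

Definition product_distribution (D : probability SV R) : Prop :=
  exists Dk : 'I_nr -> probability R R,
    forall B : 'I_nr -> set R, (forall k, measurable (B k)) ->
      D [set w | forall k, B k (tnth w k)] = (\prod_(k < nr) Dk k (B k))%E.

Variable Pi : wpts.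

Definition wf_wpts : Prop :=
  [/\ (exists M : R, forall v, supp (mu_init Pi) v -> forall i, `|tnth v i| <= M),
      product_distribution (distD Pi),
      (forall tau, List.In tau (trans Pi) ->
         [/\ t_src tau != l_out Pi,
             measurable (t_guard tau),
             \sum_(F <- t_forks tau) f_prob F = 1 &
             forall F, List.In F (t_forks tau) ->
               [/\ 0 < f_prob F <= 1,
                   measurable_fun setT (fun vr : PV * SV => f_upd F vr.1 vr.2),
                   measurable_fun setT (fun vr : PV * SV => f_wt F vr.1 vr.2) &
                   forall v r, 0 <= f_wt F v r]]) &
      forall l v, l != l_out Pi ->
        count (fun tau => (t_src tau == l) && `[< t_guard tau v >]) (trans Pi) = 1%N].

Definition enabled (l : L) (v : PV) : option transition :=
  ohead [seq tau <- trans Pi | (t_src tau == l) && `[< t_guard tau v >]].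

Inductive reachable : L -> PV -> Prop :=
| reach_init v0 : supp (mu_init Pi) v0 -> reachable (l_init Pi) v0
| reach_step l v tau F r :
    reachable l v -> l != l_out Pi -> enabled l v = Some tau ->
    List.In F (t_forks tau) -> supp (distD Pi) r ->
    reachable (f_tgt F) (f_upd F v r).

Definition bounded_update : Prop :=
  exists kappa : R, 0 < kappa /\
    forall l v tau F r i, reachable l v -> enabled l v = Some tau ->
      List.In F (t_forks tau) -> supp (distD Pi) r ->
      `|tnth (f_upd F v r) i - tnth v i| <= kappa.

(* Fork choice: with u ~ Uniform[0,1], fork j is chosen iff                 *)
(* p_0 + ... + p_{j-1} <= u < p_0 + ... + p_j, i.e. with probability p_j.   *)
Definition choose_fork (Fs : seq fork) (u : R) : option fork :=
  let j := find (fun j => u < \sum_(i < j.+1) f_prob (nth (Fork (l_out Pi) 0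
                      (fun v _ => v) (fun _ _ => 0)) Fs i)) (iota 0 (size Fs)) in
  nth None [seq Some F | F <- Fs] (minn j (size Fs).-1).

Definition wstate := (L * PV * R)%type.

Definition step (s : wstate) (u : R) (r : SV) : wstate :=
  let: (l, v, w) := s in
  if l == l_out Pi then s else
  match enabled l v with
  | None => s
  | Some tau =>
    match choose_fork (t_forks tau) u with
    | None => s
    | Some F => (f_tgt F, f_upd F v r, w * f_wt F v r)
    end
  end.

Fixpoint run (l0 : L) (v0 : PV) (U : nat -> R) (S : nat -> SV) (n : nat) : wstate :=
  match n with
  | 0 => (l0, v0, 1)
  | n'.+1 => step (run l0 v0 U S n') (U n') (S n')
  end.

Definition loc_of (s : wstate) : L := s.1.1.
Definition val_of (s : wstate) : PV := s.1.2.
Definition wt_of (s : wstate) : R := s.2.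

Definition term_time (rn : nat -> wstate) : option nat :=
  match pselect (exists n, (fun k => loc_of (rn k) == l_out Pi) n) with
  | left H => Some (ex_minn H)
  | right _ => None
  end.

Definition mutually_independent d (Om : measurableType d) (P : probability Om R)
    (I : eqType) (E : I -> set (set Om)) : Prop :=
  forall (s : seq I) (A : I -> set Om), uniq s -> (forall i, i \in s -> E i (A i)) ->
    P (\bigcap_(i in [set i | i \in s]) A i) = (\prod_(i <- s) P (A i))%E.

Definition preimages d (Om : measurableType d) d' (T : measurableType d')
    (X : Om -> T) : set (set Om) :=
  [set X @^-1` B | B in [set B : set T | measurable B]].

Definition driving_inputs d (Om : measurableType d) (P : probability Om R)
    (U : nat -> Om -> R) (S : nat -> Om -> SV) : Prop :=
  [/\ (forall n, measurable_fun setT (U n)),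
      (forall n, measurable_fun setT (S n)),
      (forall n B, measurable B -> P (U n @^-1` B) = uniform_prob (@ltr01 R) B),
      (forall n B, measurable B -> P (S n @^-1` B) = distD Pi B) &
      mutually_independent P
        (fun i : nat + nat => match i with
                              | inl n => preimages (U n)
                              | inr n => preimages (S n) end)].

Definition run_at d (Om : measurableType d) (U : nat -> Om -> R)
  (S : nat -> Om -> SV) (v : PV) (om : Om) : nat -> wstate :=
  run (l_init Pi) v (fun n => U n om) (fun n => S n om).

Definition prob_T_gt d (Om : measurableType d) (P : probability Om R)
  (U : nat -> Om -> R) (S : nat -> Om -> SV) (v : PV) (n : nat) : \bar R :=
  P [set om | forall k, (k <= n)%N -> loc_of (run_at U S v om k) != l_out Pi].

Definition expected_weight d (Om : measurableType d) (P : probability Om R)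
  (U : nat -> Om -> R) (S : nat -> Om -> SV) (v : PV) (A : set PV) : \bar R :=
  (\int[P]_om
     (match term_time (run_at U S v om) with
      | Some n => (\1_A (val_of (run_at U S v om n)) * wt_of (run_at U S v om n))%:E
      | None => 0%E
      end))%E.

(* expected-weight transformer (only used at l != l_out) *)
Definition ewt (h : L -> PV -> R) (l : L) (v : PV) : \bar R :=
  if l == l_out Pi then 1%E else
  match enabled l v with
  | None => 0%E
  | Some tau =>
    (\sum_(F <- t_forks tau)
       (f_prob F)%:E * \int[distD Pi]_r (f_wt F v r * h (f_tgt F) (f_upd F v r))%:E)%E
  end.

Definition PUWF (h : L -> PV -> R) : Prop :=
  (forall l v, reachable l v -> l != l_out Pi -> (ewt h l v <= (h l v)%:E)%E) /\
  (forall v, reachable (l_out Pi) v -> h (l_out Pi) v = 1).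

Definition PLWF (h : L -> PV -> R) : Prop :=
  (forall l v, reachable l v -> l != l_out Pi -> ((h l v)%:E <= ewt h l v)%E) /\
  (forall v, reachable (l_out Pi) v -> h (l_out Pi) v = 1).

End WPTS.

Definition is_polynomial (R : realType) (m : nat) (f : m.-tuple R -> R) : Prop :=
  exists s : seq (R * m.-tuple nat),
    forall v, f v = \sum_(c <- s) c.1 * \prod_(i < m) tnth v i ^+ tnth c.2 i.

(* Main.v *)
(* Let X_n = w_n h(l_n, v_n) be the value of h along the run, discounted by the
   accumulated weight. The state after n steps is independent of the inputs of
   step n, so the expectation of X_{n+1} is that of w_n ewt(h)(l_n, v_n) on the
   runs that have not terminated, and a PUWF (PLWF) makes E[X_n] nonincreasing
   (nondecreasing) from h(l_init, v_init). Almost surely every input lies in the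
   support of its law, so the state stays reachable, the valuation moves by at
   most n kappa and |X_n| <= C (n+1)^K e^{c3 n}. As P(T > n) <= c1 e^{-c2 n} with
   c2 > c3, the runs alive at time n contribute nothing in the limit, while on
   the terminated ones X_n is the final weight, whose expectation increases to
   the expected weight by monotone convergence. *)

Require Import Defs.
From HB Require Import structures.
From mathcomp Require Import all_boot all_order all_algebra.
From mathcomp Require Import all_classical all_reals all_analysis.
From mathcomp Require Import measurable_realfun ring lra zify.
From Stdlib Require List.

Import Order.TTheory GRing.Theory Num.Theory.
Import numFieldNormedType.Exports.
Local Open Scope classical_set_scope.
Local Open Scope ring_scope.
Set Implicit Arguments.
Unset Strict Implicit.
Unset Printing Implicit Defensive.

(** * Measure-theoretic preliminaries *)

(** A constant is integrable for a finite measure. The bound is asked only on [K] because update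
    bounds are available only for sampling valuations in the support of their law. *)
Lemma integrable_bounded_off_null d (T : measurableType d) (R : realType)
    (mu : {finite_measure set T -> \bar R}) (K : set T) (f : T -> R) (M : R) :
  measurable K -> mu (~` K) = 0%E -> measurable_fun setT f ->
  (forall x, K x -> `|f x| <= M) -> mu.-integrable setT (EFin \o f).
Proof.
move=> mK K0 mf fM.
have mCK := measurableC mK.
apply/(negligible_integrable mCK) => //; first exact/measurable_EFinP.
rewrite setTD setCK; apply: measurable_bounded_integrable => //.
- by rewrite -ge0_fin_numE// fin_num_measure.
- exact: measurable_funTS.
- exists M; split; first exact: num_real.
  by move=> N MN x /fM /le_trans; apply; exact: ltW.
Qed.

(** The fibres of [k] cut the domain into countably many measurable pieces, and on each piece a
    single measurable [g i] is in force. A step of the system, defined by cases, has this shape. *)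
Lemma measurable_fun_key d d' (X : measurableType d) (Y : measurableType d')
    (I : countType) (k : X -> I) (g : I -> X -> Y) :
  (forall i, measurable (k @^-1` [set i])) ->
  (forall i, measurable_fun setT (g i)) ->
  measurable_fun setT (fun x => g (k x) x).
Proof.
move=> mk mg _ B mB; rewrite setTI.
rewrite (_ : _ @^-1` B = \bigcup_i (k @^-1` [set i] `&` (g i) @^-1` B)).
  apply: countable_bigcupT_measurable => // i.
  by apply: measurableI => //; rewrite -[X in measurable X]setTI; exact: mg.
apply/seteqP; split=> [x Bx|x [i _ [/= <- //]]].
by exists (k x).
Qed.

Section triple_product.
Context d1 d2 d3 (T1 : measurableType d1) (T2 : measurableType d2)
  (T3 : measurableType d3) (R : realType).
Variables (m1 : {finite_measure set T1 -> \bar R})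
  (m2 : probability T2 R) (m3 : probability T3 R).

(** Uniqueness of binary product measures is used twice: first on [T2 * T3] with the side [A] held
    fixed, then on [T1 * (T2 * T3)]. *)
Lemma triple_product_measure_unique
    (m : {measure set (T1 * (T2 * T3)) -> \bar R}) :
  (forall A B C, measurable A -> measurable B -> measurable C ->
     m (A `*` (B `*` C)) = (m1 A * (m2 B * m3 C))%E) ->
  forall Q, measurable Q -> (m1 \x (m2 \x m3))%E Q = m Q.
Proof.
move=> mE Q mQ.
pose nu : probability (T2 * T3)%type R := (m2 \x m3)%E.
apply: (@product_measure_unique _ _ _ _ R m1 nu) => // A B mA mB.
have mAT : measurable (A `*` setT : set (T1 * (T2 * T3))) by exact: measurableX.
have m1A0 : 0 <= fine (m1 A) by exact: fine_ge0.
have m1AE : (fine (m1 A))%:E = m1 A by rewrite fineK// fin_num_measure.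
(* The slice of [m] over [A], as a measure on [T2 * T3]. On boxes it agrees with the product of
   [m2'] and [m3], where [m2'] absorbs the constant [m1 A]. *)
pose mA' := pushforward (mrestr m mAT) (@snd T1 (T2 * T3)).
have mA'E C : mA' C = m (A `*` C).
  rewrite /mA' /pushforward /mrestr; congr (m _).
  by apply/seteqP; split=> [[x y] /= [? []]|[x y] /= []].
have -> : m (A `*` B) = mA' B by rewrite mA'E.
pose m2' := mscale (NngNum m1A0) m2.
have <- : (m2' \x m3)%E B = mA' B.
  apply: (@product_measure_unique _ _ _ _ R m2' m3 mA') => // C D mC mD.
  transitivity (m (A `*` (C `*` D))); first exact: mA'E.
  by rewrite mE// muleA; congr (_ * _)%E; rewrite -[in LHS]m1AE.
transitivity ((fine (m1 A))%:E * nu B)%E; last by congr (_ * _)%E.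
apply: (@product_measure_unique _ _ _ _ R m2' m3
  (mscale (NngNum m1A0) nu)) => // C D mC mD.
rewrite /m2' /mscale /= -muleA; congr (_ * _)%E.
exact: (product_measure1E m2 m3).
Qed.

End triple_product.

Section law.
Context d d' (Om : measurableType d) (T : measurableType d') (R : realType).
Variable P : probability Om R.

Definition law (X : Om -> T) (mX : measurable_fun setT X) : probability T R :=
  distribution P (mfun_Sub (mem_set mX)).

Lemma integral_law (X : Om -> T) (mX : measurable_fun setT X) (f : T -> \bar R) :
  measurable_fun setT f -> P.-integrable setT (f \o X) ->
  (\int[law mX]_x f x = \int[P]_om f (X om))%E.
Proof. by move=> mf intf; rewrite [LHS](integral_pushforward mX). Qed.

Lemma integrable_law (X : Om -> T) (mX : measurable_fun setT X) (f : T -> \bar R) :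
  measurable_fun setT f ->
  (law mX).-integrable setT f <-> P.-integrable setT (f \o X).
Proof.
move=> mf; split=> intf.
- apply/integrableP; split; first exact: measurableT_comp.
  move/integrableP : intf => [_]; apply: le_lt_trans.
  by rewrite [leRHS](ge0_integral_pushforward mX)//; exact: measurableT_comp.
- exact: (integrable_pushforward mX).
Qed.

End law.

Section independent_integral.
Context d d1 d2 (Om : measurableType d) (T : measurableType d1)
  (V : measurableType d2) (R : realType).
Variables (P : probability Om R) (nu : probability V R).
Variables (X : Om -> T) (Y : Om -> V).
Hypotheses (mX : measurable_fun setT X) (mY : measurable_fun setT Y).
Hypothesis joint : forall Q, measurable Q ->
  P [set om | Q (X om, Y om)] = (law P mX \x nu)%E Q.
Variable G : T * V -> \bar R.
Hypothesis mG : measurable_fun setT G.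
Hypothesis intG : P.-integrable setT (fun om => G (X om, Y om)).

Let mXY : measurable_fun setT (fun om => (X om, Y om)).
Proof. exact: measurable_fun_pair. Qed.

Let intG' : (law P mX \x nu)%E.-integrable setT G.
Proof.
have /integrableP[_ Goo] := (integrable_law P mXY mG).2 intG.
apply/integrableP; split => //; apply: le_lt_trans Goo.
rewrite le_eqVlt; apply/orP; left; apply/eqP.
by apply: eq_measure_integral => Q mQ _; apply: esym; exact: joint.
Qed.

Let mPhi : measurable_fun setT (fun x => \int[nu]_y G (x, y))%E.
Proof. exact: measurable_fubini_F intG'. Qed.

Lemma integrable_independent :
  P.-integrable setT (fun om => \int[nu]_y G (X om, y))%E.
Proof. by apply/(integrable_law P mX mPhi)/(integrable_fubini_F intG'). Qed.

(** By [joint] the pair has a product law, so Fubini integrates [Y] out while [X] is held fixed.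
    This takes the place of a conditional expectation given [X]. *)
Lemma integral_independent :
  (\int[P]_om G (X om, Y om) = \int[P]_om \int[nu]_y G (X om, y))%E.
Proof.
rewrite -(integral_law mX mPhi integrable_independent).
rewrite [RHS](integral12_prod_meas1 intG').
rewrite -(integral_law mXY mG intG).
by apply: eq_measure_integral => Q mQ _; apply: joint.
Qed.

End independent_integral.

(** * Chains driven by independent inputs *)

Section driven_chain.
Context d d1 d2 d3 (Om : measurableType d) (T : measurableType d1)
  (V1 : measurableType d2) (V2 : measurableType d3) (R : realType).
Variables (P : probability Om R) (m2 : probability V1 R) (m3 : probability V2 R).
Variables (f : T -> V1 -> V2 -> T) (x0 : T).
Variables (U : nat -> Om -> V1) (S : nat -> Om -> V2) (X : nat -> Om -> T).
Hypothesis mf : measurable_fun setT (fun z : T * (V1 * V2) => f z.1 z.2.1 z.2.2).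
Hypothesis mU : forall n, measurable_fun setT (U n).
Hypothesis mS : forall n, measurable_fun setT (S n).
Hypothesis X0 : forall om, X 0 om = x0.
Hypothesis XS : forall n om, X n.+1 om = f (X n om) (U n om) (S n om).

(** Cylinder events over the window of steps from [n] to [n + k - 1]. The product formula
    [inputs_indep] for them records both the laws of the inputs and their independence. *)
Definition inputs_in n k (B : nat -> set V1) (C : nat -> set V2) : set Om :=
  [set om | forall i, (n <= i < n + k)%N -> B i (U i om) /\ C i (S i om)].

Hypothesis inputs_indep : forall n k B C,
  (forall i, measurable (B i)) -> (forall i, measurable (C i)) ->
  P (inputs_in n k B C) = (\prod_(n <= i < n + k) (m2 (B i) * m3 (C i)))%E.

Lemma measurable_driven n : measurable_fun setT (X n).
Proof.
elim: n => [|n mX]; first by rewrite (_ : X 0 = cst x0)//; exact/funext.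
rewrite (_ : X n.+1 = (fun z : T * (V1 * V2) => f z.1 z.2.1 z.2.2) \o
    (fun om => (X n om, (U n om, S n om)))); last exact/funext.
apply: measurableT_comp => //; apply: measurable_fun_pair => //.
exact: measurable_fun_pair.
Qed.

Lemma measurable_inputs_in n k B C :
  (forall i, measurable (B i)) -> (forall i, measurable (C i)) ->
  measurable (inputs_in n k B C).
Proof.
move=> mB mC.
rewrite (_ : inputs_in n k B C = \bigcap_(i in [set i | (n <= i < n + k)%N])
    (U i @^-1` B i `&` S i @^-1` C i)) //.
apply: bigcap_measurableType => i _; apply: measurableI.
- by rewrite -[X in measurable X]setTI; exact: mU.
- by rewrite -[X in measurable X]setTI; exact: mS.
Qed.

(* Future inputs are part of the claim because X_{n+1} depends on the inputs of
   step n: only so does independence at time n yield independence at n+1. *)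
Let indep_at n := forall k A B C, measurable A ->
  (forall i, measurable (B i)) -> (forall i, measurable (C i)) ->
  P (X n @^-1` A `&` inputs_in n k B C) =
  (P (X n @^-1` A) * \prod_(n <= i < n + k) (m2 (B i) * m3 (C i)))%E.

(** Restricting [P] to the future event and pushing it forward along [Z] gives a measure on triples.
    On a box, the inputs of step [n] join the window, so independence at [n] with [k.+1] computes
    it; uniqueness on triples extends this to every measurable [Q]. *)
Let joint_future n k B C Q : indep_at n ->
  (forall i, measurable (B i)) -> (forall i, measurable (C i)) -> measurable Q ->
  P ([set om | Q (X n om, (U n om, S n om))] `&` inputs_in n.+1 k B C) =
  ((\prod_(n.+1 <= i < n.+1 + k) (m2 (B i) * m3 (C i))) *
   (law P (measurable_driven n) \x (m2 \x m3)) Q)%E.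
Proof.
move=> IH mB mC mQ.
set e := (\prod_(_ <= i < _) _)%E.
have e_fin : e \is a fin_num.
  rewrite /e -inputs_indep//; apply: fin_num_measure.
  exact: measurable_inputs_in.
have e_ge0 : 0 <= fine e.
  by rewrite fine_ge0// /e -inputs_indep.
have mI := measurable_inputs_in n.+1 k mB mC.
pose Z om := (X n om, (U n om, S n om)).
have mZ : measurable_fun setT Z.
  apply: measurable_fun_pair; first exact: measurable_driven.
  exact: measurable_fun_pair.
pose m := pushforward (mrestr P mI) Z.
pose lX := law P (measurable_driven n).
pose m1 := mscale (NngNum e_ge0) lX.
pose nu : probability (V1 * V2)%type R := (m2 \x m3)%E.
transitivity (m Q) => //.
transitivity ((m1 \x nu)%E Q); last first.
  transitivity ((fine e)%:E * (lX \x nu)%E Q)%E; last by rewrite fineK.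
  rewrite /m1 /product_measure1 ge0_integral_mscale//.
  exact: measurable_fun_xsection.
apply: esym; apply: (@triple_product_measure_unique _ _ _ _ _ _ R m1 m2 m3 m) => //.
move=> A B0 C0 mA mB0 mC0.
(* The constraints [B0] and [C0] on the inputs of step [n] are placed in front of those on the later
   window. *)
pose B' i := if i == n then B0 else B i.
pose C' i := if i == n then C0 else C i.
transitivity (P (X n @^-1` A `&` inputs_in n k.+1 B' C')).
  rewrite /m /pushforward /mrestr; congr (P _); apply/seteqP; split.
  - move=> om [/= [? [? ?]] H]; split=> //= i /andP[ni nik].
    rewrite /B' /C'; case: eqVneq => [->//|in'].
    by apply: H; rewrite ltn_neqAle eq_sym in' ni /= addSnnS.
  - move=> om [/= AX H]; split.
      split=> //=; have := H n.
      by rewrite /B' /C' eqxx leqnn addnS leq_addr; apply.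
    move=> i /andP[ni nik]; have := H i.
    rewrite /B' /C' gtn_eqF// (ltnW ni) -addSnnS nik; exact.
rewrite IH//; last 2 first.
- by move=> i; rewrite /B'; case: ifP.
- by move=> i; rewrite /C'; case: ifP.
rewrite big_ltn ?addnS ?ltnS ?leq_addr//.
rewrite {1}/B' {1}/C' eqxx.
rewrite (eq_big_nat _ _ (F2 := fun i => (m2 (B i) * m3 (C i))%E)); last first.
  by move=> i /andP[ni _]; rewrite /B' /C' gtn_eqF.
rewrite -addSn -/e.
transitivity ((fine e)%:E * P (X n @^-1` A) * (m2 B0 * m3 C0))%E => //.
by rewrite fineK// muleCA muleA [RHS]muleAC muleC muleA.
Qed.

(** At time 0 the state is constant, so its event is sure or impossible. At time [n.+1] the event is
    pulled back through [f] to a condition on the state and inputs of step [n]. *)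
Let indep_all n : indep_at n.
Proof.
elim: n => [|n IH] k A B C mA mB mC.
  have [Ax|Ax] := pselect (A x0).
    rewrite (_ : X 0 @^-1` A = setT) ?setTI ?probability_setT ?mul1e//.
      exact: inputs_indep.
    by apply/seteqP; split => om //= _; rewrite X0.
  rewrite (_ : X 0 @^-1` A = set0) ?set0I ?measure0 ?mul0e//.
  by apply/seteqP; split => om //=; rewrite X0.
pose Q := (fun z : T * (V1 * V2) => f z.1 z.2.1 z.2.2) @^-1` A.
have mQ : measurable Q by rewrite -[X in measurable X]setTI; exact: mf.
have XQ : X n.+1 @^-1` A = [set om | Q (X n om, (U n om, S n om))].
  by apply/seteqP; split => om; rewrite /Q /= XS.
rewrite XQ joint_future// muleC; congr (_ * _)%E.
(* With an empty window the same identity evaluates the probability of the state event alone, which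
   is the remaining factor. *)
have := joint_future 0 IH mB mC mQ.
rewrite addn0 big_geq// mul1e => <-; congr (P _).
by rewrite setIidl// => om _ i; case: ltngtP => //; lia.
Qed.

Lemma driven_joint n Q : measurable Q ->
  P [set om | Q (X n om, (U n om, S n om))] =
  (law P (measurable_driven n) \x (m2 \x m3))%E Q.
Proof.
move=> mQ.
have mT1 (i : nat) : measurable [set: V1] by [].
have mT2 (i : nat) : measurable [set: V2] by [].
have := joint_future 0 (@indep_all n) mT1 mT2 mQ.
rewrite addn0 big_geq// mul1e => <-; congr (P _).
by rewrite setIidl.
Qed.

End driven_chain.

(** * Supports and inverse transform sampling *)

Section support.
Context (R : realType) (m : nat).
Local Notation V := (m.-tuple R).

Lemma measurable_sup_ball (v : V) (e : R) : measurable (sup_ball v e).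
Proof.
rewrite (_ : sup_ball v e = \bigcap_(i in [set: 'I_m])
    ((fun w : V => `|tnth w i - tnth v i|) @^-1` `]-oo, e[)); last first.
  apply/seteqP; split=> [w we i _|w we i]; first by rewrite /= in_itv/= we.
  by have := we i I; rewrite /= in_itv.
apply: fin_bigcap_measurable => // i _.
rewrite -[X in measurable X]setTI.
have mf : measurable_fun setT (fun w : V => `|tnth w i - tnth v i|).
  apply: measurableT_comp => //; apply: measurable_funB => //.
  exact: measurable_tnth.
exact: mf.
Qed.

Definition rat_ball (c : m.-tuple rat * rat) : set V :=
  sup_ball (map_tuple (@ratr R) c.1) (ratr c.2).

Lemma rat_ball_between (v : V) (e : R) : 0 < e ->
  exists2 c, rat_ball c v & rat_ball c `<=` sup_ball v e.
Proof.
move=> e0.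
(* The centre lies within [e / 4] of [v] and the radius between [e / 4] and [e / 2], so the ball
   contains [v] and stays within [3 e / 4] of it. *)
have /choice[q qP] : forall i, exists q : rat, `|tnth v i - ratr q| < e / 4.
  move=> i.
  have : tnth v i - e / 4 < tnth v i + e / 4 by lra.
  move=> /rat_in_itvoo[q]; rewrite in_itv/= => /andP[q1 q2]; exists q.
  by rewrite ltr_norml; apply/andP; split; lra.
have : e / 4 < e / 2 by lra.
move=> /rat_in_itvoo[r]; rewrite in_itv/= => /andP[r1 r2].
exists (mktuple q, r).
  move=> i /=; rewrite tnth_map tnth_mktuple.
  exact: (lt_trans (qP i)).
move=> w /= wq i; have := wq i; have := qP i.
rewrite /= tnth_map tnth_mktuple !ltr_norml => /andP[? ?] /andP[? ?].
by apply/andP; split; lra.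
Qed.

(** A point outside the support has a null ball around it, hence lies in a null ball with rational
    centre and radius. There are countably many of these, so removing them all costs no mass and
    leaves a measurable set. *)
Lemma supp_full (mu : probability V R) :
  exists K : set V, [/\ measurable K, mu (~` K) = 0%E & K `<=` supp mu].
Proof.
pose F c : set V := if mu (rat_ball c) == 0%E then rat_ball c else set0.
have mF c : measurable (F c).
  by rewrite /F; case: ifP => _ //; exact: measurable_sup_ball.
have F0 c : mu (F c) = 0%E.
  by rewrite /F; case: ifPn => [/eqP//|_]; rewrite measure0.
pose N := \bigcup_c F c.
have mN : measurable N by exact: countable_bigcupT_measurable.
exists (~` N); split; first exact: measurableC.
  (* The null balls are listed along the natural numbers, with the empty set at codes that decode to
     nothing. *)
  rewrite setCK; pose G n := if unpickle n is Some c then F c else set0.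
  have NG : N = \bigcup_n G n.
    apply/seteqP; split=> [v [c _ Fv]|v [n _]].
      by exists (pickle c) => //; rewrite /G pickleK.
    by rewrite /G; case: unpickle => // c Fv; exists c.
  have mG n : measurable (G n) by rewrite /G; case: unpickle.
  apply: measure_negligible => //; rewrite NG; apply: negligible_bigcup => n.
  apply: (negligibleP mu (mG n)).2; rewrite /G; case: unpickle => // c.
move=> v Nv e e0; rewrite lt0e measure_ge0 andbT.
apply/negP => /eqP ve0; apply: Nv.
have [c cv ce] := rat_ball_between v e0; exists c => //.
rewrite /F ifT//; apply/eqP/(subset_measure0 _ _ ce) => //;
  exact: measurable_sup_ball.
Qed.

End support.

Lemma measurable_find d (T : measurableType d) (I : Type) (s : seq I)
    (a : I -> T -> bool) (j : nat) :
  (forall i, List.In i s -> measurable [set x | a i x]) ->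
  measurable [set x | find (a^~ x) s = j].
Proof.
elim: s j => [|i s IH] j ma /=.
  by have [->|/eqP j0] := eqVneq 0%N j; [rewrite (_ : [set _ | _] = setT)|
    rewrite (_ : [set _ | _] = set0)] => //; apply/seteqP; split.
have mi : measurable [set x | a i x] by apply: ma; left.
have ms k : measurable [set x | find (a^~ x) s = k].
  by apply: IH => i' i's; apply: ma; right.
case: j => [|j].
  rewrite (_ : [set _ | _] = [set x | a i x])//.
  by apply/seteqP; split=> x /=; case: (a i x).
rewrite (_ : [set _ | _] = ~` [set x | a i x] `&` [set x | find (a^~ x) s = j]).
  by apply: measurableI => //; exact: measurableC.
apply/seteqP; split=> x /=; case: (a i x) => //=.
- by move=> [->].
- by move=> [].
- by move=> [_ ->].
Qed.

Lemma ohead_filter_find (I : Type) (a : pred I) (s : seq I) :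
  ohead [seq i <- s | a i] = nth None (map Some s) (find a s).
Proof. by elim: s => //= i s IH; case: (a i). Qed.

Lemma uniform_probE (R : realType) (B : set R) : measurable B ->
  uniform_prob (@ltr01 R) B = lebesgue_measure (B `&` `[0, 1]).
Proof.
move=> mB; rewrite /uniform_prob integral_uniform_pdf.
rewrite (eq_integral (fun=> 1%E)).
  by rewrite integral_cst ?mul1e//; exact: measurableI.
move=> x; rewrite inE /= in_itv /= => -[_ x01].
by rewrite /uniform_pdf x01 subr0 invr1.
Qed.

Section inverse_cdf.
Context (R : realType) (p : nat -> R) (k : nat).
Hypothesis p_ge0 : forall i, 0 <= p i.
Hypothesis p_sum : \sum_(i < k) p i = 1.
Hypothesis k_gt0 : (0 < k)%N.

Local Notation c j := (\sum_(i < j) p i).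

(** The quantile function of the distribution [p] on the first [k] indices. When the search fails,
    as at [u = 1], it returns [k], which the cap [k.-1] turns into the last index. *)
Definition inverse_cdf (u : R) : nat :=
  minn (find (fun j => u < \sum_(i < j.+1) p i) (iota 0 k)) k.-1.

Lemma cdf_homo i j : (i <= j)%N -> c i <= c j.
Proof.
elim: j => [|j IH]; first by rewrite leqn0 => /eqP ->.
rewrite leq_eqVlt => /predU1P[->//|]; rewrite ltnS => /IH /le_trans; apply.
by rewrite big_ord_recr /= lerDl.
Qed.

(** A Galois connection between indices and partial sums, due to monotonicity of the partial sums.
    It turns fibres of the search into intervals. *)
Lemma leq_find_cdf (u : R) j : 0 <= u -> (j <= k)%N ->
  (j <= find (fun j => (u < \sum_(i < j.+1) p i)%R) (iota 0 k))%N = (c j <= u).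
Proof.
move=> u0 jk; set t := find _ _; apply/idP/idP => [|cu].
  case: j jk => [|j jk jt]; first by rewrite big_ord0.
  have := before_find 0%N jt; rewrite nth_iota// add0n => /negbT.
  by rewrite -leNgt.
rewrite leqNgt; apply/negP => tj.
have tk : (t < k)%N := leq_trans tj jk.
have : has (fun j => u < \sum_(i < j.+1) p i) (iota 0 k).
  by rewrite has_find size_iota.
move=> /(nth_find 0%N); rewrite -/t nth_iota// add0n ltNge => /negP; apply.
exact: le_trans (cdf_homo tj) cu.
Qed.

Lemma measurable_inverse_cdf j : measurable [set u | inverse_cdf u = j].
Proof.
rewrite (_ : [set _ | _] = \bigcup_(i in [set i | minn i k.-1 = j])
   [set u | find (fun j => u < \sum_(i < j.+1) p i) (iota 0 k) = i]).
  apply: bigcup_measurable => i _.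
  apply: (@measurable_find _ _ _ _ (fun j (u : R) => u < \sum_(i < j.+1) p i)).
  move=> n _; rewrite (_ : [set _ | _] = `]-oo, \sum_(i < n.+1) p i[%classic)//.
apply/seteqP; split=> [u /= uj|u [i /= <- <-]//].
by exists (find (fun j => u < \sum_(i < j.+1) p i) (iota 0 k)).
Qed.

Lemma uniform_inverse_cdf j : (j < k)%N ->
  uniform_prob (@ltr01 R) [set u | inverse_cdf u = j] = (p j)%:E.
Proof.
move=> jk; rewrite uniform_probE; last exact: measurable_inverse_cdf.
have c0 : 0 <= c j by apply: sumr_ge0 => i _.
have cS : c j.+1 = c j + p j by rewrite big_ord_recr.
have c1 : c j.+1 <= 1 by rewrite -p_sum; exact: cdf_homo.
(* Below the last index the fibre is the half-open interval from [c j] to [c j.+1]; the last fibre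
   also receives [u = 1] through the cap and is closed. *)
have [jk1|jk1] := ltnP j k.-1.
- rewrite (_ : _ `&` _ = `[c j, c j.+1[%classic); last first.
    apply/seteqP; split=> [u [/= uj]|u /=]; rewrite /= !in_itv/=.
    + move=> /andP[u0 u1]; rewrite ltNge -!leq_find_cdf// ?(ltnW jk)//.
      by move: uj; rewrite /inverse_cdf; lia.
    + move=> /andP[cu uc].
      have u0 : 0 <= u by exact: le_trans cu.
      split; last by rewrite u0 (le_trans (ltW uc)).
      move: cu uc; rewrite ltNge -!leq_find_cdf// ?(ltnW jk)//.
      by rewrite /inverse_cdf; lia.
  rewrite lebesgue_measure_itv/= lte_fin cS ltrDl.
  case: ltP => [_|pj]; first by rewrite -EFinB; congr EFin; ring.
  by congr EFin; apply/esym/le_anti; rewrite pj p_ge0.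
- have jE : j = k.-1 by lia.
  have kE : j.+1 = k by lia.
  rewrite (_ : _ `&` _ = `[c j, 1]%classic); last first.
    apply/seteqP; split=> [u [/= uj]|u /=]; rewrite /= !in_itv/=.
    + move=> /andP[u0 u1]; rewrite u1 andbT -!leq_find_cdf// ?(ltnW jk)//.
      by move: uj; rewrite /inverse_cdf; lia.
    + move=> /andP[cu u1].
      have u0 : 0 <= u by exact: le_trans cu.
      split; last by rewrite u0.
      move: cu; rewrite -!leq_find_cdf// ?(ltnW jk)//.
      by rewrite /inverse_cdf; lia.
  rewrite lebesgue_measure_itv/= lte_fin -[X in _ < X]p_sum -kE cS ltrDl.
  case: ltP => [_|pj].
    by rewrite -EFinB; congr EFin; rewrite -p_sum -kE cS; ring.
  by congr EFin; apply/esym/le_anti; rewrite pj p_ge0.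
Qed.

End inverse_cdf.

(** * Growth of polynomials *)

Lemma exp_decay_beats_pow (R : realType) (C dlt eps : R) (K : nat) :
  0 <= C -> 0 < dlt -> 0 < eps ->
  exists N, forall n, (N <= n)%N ->
    C * n.+1%:R ^+ K * expR (- (dlt * n%:R)) <= eps.
Proof.
move=> C0 d0 e0.
(* The term of order [K.+1] of the exponential series bounds [expR (- x)] by [(K.+1)! / x ^ K.+1].
   With [x = dlt * n.+1] this leaves [C' / n.+1], and the factor [expR dlt] pays for passing from
   [n] to [n.+1]. *)
pose C' := C * expR dlt * (K.+1)`!%:R / dlt ^+ K.+1.
have C'0 : 0 <= C'.
  by rewrite !mulr_ge0 ?invr_ge0 ?exprn_ge0 ?expR_ge0// ltW.
exists (Num.bound (C' / eps)) => n Nn.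
have n0 : 0 < n.+1%:R :> R by rewrite ltr0n.
apply: (@le_trans _ _ (C' / n.+1%:R)); last first.
  rewrite ler_pdivrMr// mulrC -ler_pdivrMr//.
  rewrite (le_trans (ltW (archi_boundP _)))//; first by rewrite divr_ge0// ltW.
  by rewrite ler_nat (leq_trans Nn).
have -> : - (dlt * n%:R) = dlt - dlt * n.+1%:R by rewrite -natr1; ring.
have x0 : 0 < dlt * n.+1%:R by rewrite mulr_gt0.
have := expR_ge1Dxn K (ltW x0); set x := dlt * n.+1%:R in x0 *.
move=> /(le_trans (ler_wpDl ler01 (lexx _))) xe.
have f0 : 0 < (K.+1)`!%:R :> R by rewrite ltr0n fact_gt0.
have xK : 0 < x ^+ K.+1 by rewrite exprn_gt0.
have ex : expR (- x) <= (K.+1)`!%:R / x ^+ K.+1.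
  rewrite expRN -[leRHS]invrK lef_pV2 ?posrE ?expR_gt0//; last first.
    by rewrite invr_gt0 divr_gt0.
  by rewrite invf_div.
rewrite expRD mulrA -/x.
apply: (@le_trans _ _ (C * n.+1%:R ^+ K * expR dlt * ((K.+1)`!%:R / x ^+ K.+1))).
  by rewrite ler_wpM2l// !mulr_ge0 ?expR_ge0 ?exprn_ge0.
rewrite /C' /x exprMn [n.+1%:R ^+ K.+1]exprS.
rewrite le_eqVlt; apply/orP; left; apply/eqP.
by field; rewrite ?lt0r_neq0 ?exprn_gt0.
Qed.

Section polynomials.
Context (R : realType) (m : nat).

Lemma measurable_polynomial (f : m.-tuple R -> R) :
  is_polynomial f -> measurable_fun setT f.
Proof.
move=> [s fE]; rewrite (_ : f = fun v => \sum_(c <- s) c.1 *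
  \prod_(i < m) tnth v i ^+ tnth c.2 i); last exact/funext.
apply: measurable_sum => c; apply: measurable_funM => //.
apply: measurable_prod => i _; apply: measurable_funX.
exact: measurable_tnth.
Qed.

Lemma polynomial_bound (f : m.-tuple R -> R) : is_polynomial f ->
  exists C K, 0 <= C /\ forall v (B : R), 1 <= B ->
    (forall i, `|tnth v i| <= B) -> `|f v| <= C * B ^+ K.
Proof.
move=> [s fE].
(* The sum of all exponents of all monomials is a crude degree; since [1 <= B], raising the exponent
   only weakens the bound. *)
exists (\sum_(c <- s) `|c.1|), (\sum_(c <- s) \sum_(i < m) tnth c.2 i)%N.
split; first by apply: sumr_ge0.
move=> v B B1 vB; rewrite fE mulr_suml (le_trans (ler_norm_sum _ _ _))//.
rewrite big_seq [leRHS]big_seq; apply: ler_sum => c cs.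
rewrite normrM ler_wpM2l// normr_prod.
apply: (@le_trans _ _ (B ^+ (\sum_(i < m) tnth c.2 i)%N)).
  rewrite -prodrXr; apply: ler_prod => i _; rewrite normr_ge0 normrX /=.
  by rewrite lerXn2r ?nnegrE// (le_trans ler01).
by rewrite ler_weXn2l// (big_rem c)//= leq_addr.
Qed.

Lemma polynomial_bound_fin (L : finType) (h : L -> m.-tuple R -> R) :
  (forall l, is_polynomial (h l)) ->
  exists C K, 0 <= C /\ forall l v (B : R), 1 <= B ->
    (forall i, `|tnth v i| <= B) -> `|h l v| <= C * B ^+ K.
Proof.
move=> hp.
have /choice[CK CKP] : forall l, exists CK : R * nat, 0 <= CK.1 /\
    forall v (B : R), 1 <= B ->
    (forall i, `|tnth v i| <= B) -> `|h l v| <= CK.1 * B ^+ CK.2.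
  by move=> l; have [C [K CKP]] := polynomial_bound (hp l); exists (C, K).
have C0 l : 0 <= (CK l).1 by have [] := CKP l.
exists (\sum_l (CK l).1), (\sum_l (CK l).2)%N; split; first exact: sumr_ge0.
move=> l v B B1 vB; apply: le_trans ((CKP l).2 v B B1 vB) _.
apply: ler_pM => //; first by rewrite exprn_ge0// (le_trans ler01).
- by rewrite (bigD1 l)//= lerDl sumr_ge0.
- by rewrite ler_weXn2l// (bigD1 l)//= leq_addr.
Qed.

End polynomials.

(** * One step of a WPTS *)

(** A copy of [L] that carries the discrete sigma-algebra. It depends on [Pi] so that [l_init Pi]
    can serve as its distinguished point. *)
Definition dloc (R : realType) (np nr : nat) (L : finType) (Pi : wpts R np nr L) :
  Type := L.

Section dloc_measurable.
Context (R : realType) (np nr : nat) (L : finType) (Pi : wpts R np nr L).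

HB.instance Definition _ := Finite.on (dloc Pi).
HB.instance Definition _ := isPointed.Build (dloc Pi) (l_init Pi).
HB.instance Definition _ := @isMeasurable.Build default_measure_display
  (dloc Pi) discrete_measurable discrete_measurable0
  discrete_measurableC discrete_measurableU.

End dloc_measurable.

Lemma nth_SomeP (T : Type) (s : seq T) n x :
  nth None (map Some s) n = Some x -> List.In x s.
Proof.
elim: s n => [|y s IH] [|n] //=; first by case=> ->; left.
by move=> H; right; exact: IH H.
Qed.

Lemma In_nth (T : Type) (x0 : T) (s : seq T) n :
  (n < size s)%N -> List.In (nth x0 s n) s.
Proof. by elim: s n => [|y s IH] [|n] //=; [left|rewrite ltnS => /IH; right]. Qed.

Section wpts_step.
Context (R : realType) (np nr : nat) (L : finType) (Pi : wpts R np nr L).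
Hypothesis wf : wf_wpts Pi.
Local Notation PV := (np.-tuple R).
Local Notation SV := (nr.-tuple R).
Local Notation state := (dloc Pi * PV * R)%type.
Local Notation noFork :=
  (Fork (np := np) (nr := nr) (l_out Pi) 0 (fun v _ => v) (fun _ _ => 0)).

(** The default fork is the one in [choose_fork], which makes [choose_forkE] hold by computation.
    Its probability 0 keeps the sequence nonnegative beyond the end of the list. *)
Definition fork_prob (Fs : seq (fork R np nr L)) (i : nat) : R :=
  f_prob (nth noFork Fs i).

Lemma choose_forkE Fs u : choose_fork Pi Fs u =
  nth None [seq Some F | F <- Fs] (inverse_cdf (fork_prob Fs) (size Fs) u).
Proof. by []. Qed.

Lemma enabledE (l : L) (v : PV) : enabled Pi l v = nth None (map Some (trans Pi))
  (find (fun tau => (t_src tau == l) && `[< t_guard tau v >]) (trans Pi)).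
Proof. exact: ohead_filter_find. Qed.

Lemma enabled_In (l : L) (v : PV) tau :
  enabled Pi l v = Some tau -> List.In tau (trans Pi).
Proof. by rewrite enabledE; exact: nth_SomeP. Qed.

Lemma enabled_ex (l : L) (v : PV) : l != l_out Pi ->
  exists tau, enabled Pi l v = Some tau.
Proof.
move=> ll; case: wf => _ _ _ /(_ l v ll).
rewrite /enabled -size_filter; case: [seq _ <- _ | _] => //= tau s _.
by exists tau.
Qed.

Lemma fork_spec tau F : List.In tau (trans Pi) -> List.In F (t_forks tau) ->
  [/\ 0 < f_prob F <= 1,
      measurable_fun setT (fun vr : PV * SV => f_upd F vr.1 vr.2),
      measurable_fun setT (fun vr : PV * SV => f_wt F vr.1 vr.2) &
      forall v r, 0 <= f_wt F v r].
Proof. by case: wf => _ _ H _ tT FT; case: (H tau tT) => _ _ _; exact. Qed.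

(** Once the location, the index of the enabled transition and the index of the chosen fork are
    fixed, a step is either the identity or one measurable fork map. These three data form the
    countable key. *)
Lemma measurable_step : measurable_fun setT
  (fun z : state * (R * SV) => (step Pi z.1 z.2.1 z.2.2 : state)).
Proof.
pose loc (z : state * (R * SV)) : dloc Pi := z.1.1.1.
pose tix (z : state * (R * SV)) := find (fun tau => (t_src tau == (z.1.1.1 : L))
  && `[< t_guard tau z.1.1.2 >]) (trans Pi).
pose forks t := if nth None (map Some (trans Pi)) t is Some tau then t_forks tau
  else [::].
(* The transition index is a parameter here: on the piece where it equals [t] the list of forks is
   fixed, so the fork index depends on the uniform input alone. *)
pose fix_ t (z : state * (R * SV)) :=
  inverse_cdf (fork_prob (forks t)) (size (forks t)) z.2.1.
pose key z : L * nat * nat := (loc z, tix z, fix_ (tix z) z).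
pose g (i : L * nat * nat) (z : state * (R * SV)) : state :=
  if (i.1.1 : L) == l_out Pi then z.1 else
  if nth None (map Some (trans Pi)) i.1.2 is Some tau then
    if nth None (map Some (t_forks tau)) i.2 is Some F then
      (f_tgt F, f_upd F z.1.1.2 z.2.2, z.1.2 * f_wt F z.1.1.2 z.2.2)
    else z.1
  else z.1.
rewrite (_ : (fun z => _) = fun z => g (key z) z); last first.
  apply/funext => -[[[l v] w] [u r]]; rewrite /g /key /step /loc /=.
  case: ifP => // _; rewrite enabledE /fix_ /forks /tix /=.
  by case: nth => // tau.
have mloc : measurable_fun setT loc.
  apply: (@measurableT_comp _ _ _ _ _ _ fst) => //.
  by apply: (@measurableT_comp _ _ _ _ _ _ fst).
have mval : measurable_fun setT (fun z : state * (R * SV) => z.1.1.2).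
  apply: (@measurableT_comp _ _ _ _ _ _ snd) => //.
  by apply: (@measurableT_comp _ _ _ _ _ _ fst).
have mwt : measurable_fun setT (fun z : state * (R * SV) => z.1.2).
  by apply: (@measurableT_comp _ _ _ _ _ _ snd).
have mu : measurable_fun setT (fun z : state * (R * SV) => z.2.1).
  by apply: (@measurableT_comp _ _ _ _ _ _ fst).
have mr : measurable_fun setT (fun z : state * (R * SV) => z.2.2).
  by apply: (@measurableT_comp _ _ _ _ _ _ snd).
have mtix t : measurable [set z | tix z = t].
  apply: (@measurable_find _ _ _ _ (fun tau (z : state * (R * SV)) =>
    (t_src tau == (z.1.1.1 : L)) && `[< t_guard tau z.1.1.2 >])) => tau tT.
  case: wf => _ _ H _; case: (H tau tT) => _ mguard _ _.
  rewrite (_ : [set _ | _] = loc @^-1` [set t_src tau] `&`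
      (fun z : state * (R * SV) => z.1.1.2) @^-1` t_guard tau).
    by apply: measurableI; rewrite -[X in measurable X]setTI;
      [exact: mloc|exact: mval].
  apply/seteqP; split=> z /=.
    by move=> /andP[/eqP ? /asboolP ?].
  by move=> [locz ?]; apply/andP; split; [apply/eqP/esym|apply/asboolP].
apply: measurable_fun_key => [[[l t] j]|[[l t] j]].
- rewrite (_ : _ @^-1` _ = loc @^-1` [set l] `&` [set z | tix z = t] `&`
      (fun z : state * (R * SV) => z.2.1) @^-1`
        [set u | inverse_cdf (fork_prob (forks t)) (size (forks t)) u = j]).
    apply: measurableI; first apply: measurableI => //.
      by rewrite -[X in measurable X]setTI; exact: mloc.
    rewrite -[X in measurable X]setTI; apply: mu => //.
    exact: measurable_inverse_cdf.
  apply/seteqP; split=> z /=; rewrite /key.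
    by move=> [<- <- <-].
  by move=> [[<- <-] <-].
- have mfst : measurable_fun setT (fun z : state * (R * SV) => z.1).
    exact: measurable_fst.
  rewrite /g /=; case: ((l : L) == l_out Pi); first exact: mfst.
  case nt: (nth None (map Some (trans Pi)) t) => [tau|]; last exact: mfst.
  case nF: (nth None (map Some (t_forks tau)) j) => [F|]; last exact: mfst.
  have [_ mupd mfwt _] := fork_spec (nth_SomeP nt) (nth_SomeP nF).
  have mvr : measurable_fun setT
    (fun z : state * (R * SV) => (z.1.1.2, z.2.2)) by exact: measurable_fun_pair.
  have mtgt : measurable_fun setT
      (fun z : state * (R * SV) => (f_tgt F, f_upd F z.1.1.2 z.2.2) : dloc Pi * PV).
    apply: (@measurable_fun_pair _ _ _ _ (dloc Pi) PV (fun=> f_tgt F)) => //.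
    exact: (measurableT_comp mupd mvr).
  have mw : measurable_fun setT (fun z : state * (R * SV) =>
      z.1.2 * f_wt F z.1.1.2 z.2.2).
    by apply: measurable_funM => //; exact: (measurableT_comp mfwt mvr).
  exact: (measurable_fun_pair mtgt mw).
Qed.

End wpts_step.

Lemma measurable_id_measurableTypeR (R : realType) :
  measurable_fun setT (idfun : measurableTypeR R -> R).
Proof. by move=> _ B mB; rewrite setTI. Qed.

(* [uniform_prob] lives on [measurableTypeR R], whose display differs from that
   of [R]; its image under the identity is the same measure on [R] itself. *)
Definition unif01 (R : realType) : probability R R :=
  law (uniform_prob (@ltr01 R)) (@measurable_id_measurableTypeR R).

(** The integrand is a finite combination of indicators of the fibres of [inverse_cdf]. Integrating
    the uniform input out thus yields the probability-weighted sum over forks that occurs in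
    [ewt]. *)
Lemma integral_inverse_cdf (R : realType) (p : nat -> R) (k : nat) (g : nat -> R) :
  (forall i, 0 <= p i) -> \sum_(i < k) p i = 1 -> (0 < k)%N ->
  (\int[unif01 R]_u (g (inverse_cdf p k u))%:E =
   (\sum_(j < k) p j * g j)%:E)%E.
Proof.
move=> p0 p1 k0.
pose A (j : nat) := [set u | inverse_cdf p k u = j].
have mA j : measurable (A j) by exact: measurable_inverse_cdf.
have gE u : ((g (inverse_cdf p k u))%:E =
    \sum_(j < k) (g j * \1_(A j) u)%:E)%E.
  have idx : (inverse_cdf p k u < k)%N by rewrite /inverse_cdf; lia.
  rewrite sumEFin; congr EFin; rewrite (bigD1 (Ordinal idx))//= big1 ?addr0.
    by rewrite indicE mem_set ?mulr1.
  move=> j jn; rewrite indicE memNset ?mulr0//.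
  by move=> /= uj; move: jn; rewrite -val_eqE /= -uj eqxx.
transitivity (\int[unif01 R]_u
    (\sum_(j < k) (g j * \1_(A j) u)%:E))%E.
  by apply: eq_integral => u _; exact: gE.
have int1 (j : nat) : (unif01 R).-integrable setT (EFin \o \1_(A j)).
  apply: (@integrable_bounded_off_null _ _ _ _ setT _ 1) => //.
    by rewrite setCT measure0.
  by move=> u _; rewrite indicE ger0_norm ?ler0n// lern1 leq_b1.
rewrite integral_sum//; last first.
  by move=> j; exact: (integrableZl measurableT (g j) (int1 j)).
rewrite -sumEFin; apply: eq_bigr => j _.
rewrite [LHS](integralZl measurableT (int1 j)) integral_indic// setIT muleC EFinM.
congr (_ * _)%E.
exact: uniform_inverse_cdf.
Qed.

(** * Expected value of one step and the transformer [ewt] *)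

Section expected_step.
Context (R : realType) (np nr : nat) (L : finType) (Pi : wpts R np nr L).
Variables (c3 : R) (h : L -> np.-tuple R -> R).
Hypothesis wf : wf_wpts Pi.
Hypothesis bu : bounded_update Pi.
Hypothesis wt_bound : forall tau F, List.In tau (trans Pi) ->
  List.In F (t_forks tau) -> forall v r, `|f_wt F v r| <= expR c3.
Hypothesis hpoly : forall l, is_polynomial (h l).
Local Notation PV := (np.-tuple R).
Local Notation SV := (nr.-tuple R).
Local Notation state := (dloc Pi * PV * R)%type.
Local Notation noFork :=
  (Fork (np := np) (nr := nr) (l_out Pi) 0 (fun v _ => v) (fun _ _ => 0)).

Definition weighted_value (s : state) : R := s.2 * h s.1.1 s.1.2.

Lemma measurable_weighted_value : measurable_fun setT weighted_value.
Proof.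
have mloc : measurable_fun setT (fun s : state => s.1.1).
  by apply: (@measurableT_comp _ _ _ _ _ _ fst).
have mval : measurable_fun setT (fun s : state => s.1.2).
  by apply: (@measurableT_comp _ _ _ _ _ _ snd).
apply: measurable_funM; first exact: measurable_snd.
apply: (@measurable_fun_key _ _ _ _ L (fun s : state => s.1.1)
  (fun l s => h l s.1.2)) => l.
  by rewrite -[X in measurable X]setTI; exact: mloc.
apply: (measurableT_comp _ mval); exact: measurable_polynomial.
Qed.

Definition input_law : probability (R * SV)%type R :=
  (unif01 R \x distD Pi)%E.

Lemma integrable_step (K : set SV) (M : R) (s : state) :
  measurable K -> distD Pi (~` K) = 0%E ->
  (forall u r, K r -> `|weighted_value (step Pi s u r)| <= M) ->
  input_law.-integrable setT
    (fun ur => (weighted_value (step Pi s ur.1 ur.2))%:E).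
Proof.
move=> mK K0 sM.
have mTK : measurable (setT `*` K : set (R * SV)) by exact: measurableX.
apply: (@integrable_bounded_off_null _ _ _ _ (setT `*` K) _ M) => //.
- rewrite (_ : ~` _ = setT `*` ~` K).
    transitivity ((unif01 R setT * distD Pi (~` K))%E).
      by apply: product_measure1E => //; exact: measurableC.
    by rewrite K0 mule0.
  apply/seteqP; split=> [[u r] /= H|[u r] /= [_ nK] [_ /nK]//].
  by split => // Kr; apply: H.
- have mF := measurableT_comp measurable_weighted_value (measurable_step wf).
  have mi : measurable_fun setT (fun ur : R * SV => (s, ur)).
    exact: measurable_fun_pair.
  exact: (measurableT_comp mF mi).
- by move=> [u r] /= [_ Kr]; exact: sM.
Qed.

Lemma step_value_bound (v : PV) (l : L) : reachable Pi l v ->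
  exists M, forall tau F r, enabled Pi l v = Some tau ->
    List.In F (t_forks tau) -> supp (distD Pi) r ->
    `|f_wt F v r * h (f_tgt F) (f_upd F v r)| <= M.
Proof.
move=> lv; have [kap [kap0 bupd]] := bu.
have [C [K [C0 hCK]]] := polynomial_bound_fin hpoly.
(* The sum dominates every coordinate of [v], [kap] covers one update, and the summand 1 brings the
   radius above 1 as the polynomial bound requires. *)
exists (expR c3 * (C * (1 + \sum_i `|tnth v i| + kap) ^+ K)) => tau F r en FT Dr.
rewrite normrM; apply: ler_pM => //.
  exact: (wt_bound (enabled_In en)).
apply: hCK => [|i]; first by rewrite -addrA lerDl addr_ge0 ?sumr_ge0// ltW.
have := bupd _ _ _ _ _ i lv en FT Dr.
have : `|tnth v i| <= \sum_i `|tnth v i| by rewrite (bigD1 i)//= lerDl sumr_ge0.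
have := ler_normD (tnth (f_upd F v r) i - tnth v i) (tnth v i).
by rewrite subrK; lra.
Qed.

Lemma expected_step_out (s : state) : loc_of s = l_out Pi ->
  (\int[input_law]_ur (weighted_value (step Pi s ur.1 ur.2))%:E =
   (weighted_value s)%:E)%E.
Proof.
case: s => [[l v] w]; rewrite /loc_of /= => lE.
rewrite (eq_integral (fun=> (weighted_value (l, v, w))%:E)).
  by rewrite integral_cst// [X in (_ * X)%E](probability_setT input_law) mule1.
by move=> [u r] _ /=; rewrite lE eqxx.
Qed.

(** Fubini with the sampling valuation innermost: at fixed [u] the fork is fixed and the inner
    integral is [w * I (idx u)]; the integral over [u] then weights the forks by their
    probabilities. *)
Lemma expected_step (l : L) (v : PV) (w : R) : reachable Pi l v ->
  l != l_out Pi ->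
  (\int[input_law]_ur (weighted_value (step Pi (l, v, w) ur.1 ur.2))%:E =
   w%:E * ewt Pi h l v)%E.
Proof.
move=> lv ll.
have [K [mK K0 Ksupp]] := supp_full (distD Pi).
have [M Mbound] := step_value_bound lv.
have [tau en] := enabled_ex wf v ll.
have tT := enabled_In en.
set Fs := t_forks tau; set k := size Fs.
have fsum : \sum_(i < k) fork_prob Pi Fs i = 1.
  case: wf => _ _ /(_ tau tT)[_ _ <- _] _.
  by rewrite (big_nth noFork) big_mkord.
have k0 : (0 < k)%N.
  by case: (k) fsum => // /esym/eqP; rewrite big_ord0 oner_eq0.
have p0 i : 0 <= fork_prob Pi Fs i.
  have [ik|ki] := ltnP i k; last by rewrite /fork_prob nth_default.
  by have [/andP[/ltW]] := fork_spec wf tT (In_nth noFork ik).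
pose idx u := inverse_cdf (fork_prob Pi Fs) k u.
have idxk u : (idx u < k)%N by rewrite /idx /inverse_cdf; lia.
pose a j r := f_wt (nth noFork Fs j) v r *
  h (f_tgt (nth noFork Fs j)) (f_upd (nth noFork Fs j) v r).
have stepE u r : weighted_value (step Pi (l, v, w) u r) = w * a (idx u) r.
  rewrite /step (negbTE ll) en choose_forkE (nth_map noFork)//.
  by rewrite /weighted_value /= mulrA.
have aM j r : (j < k)%N -> K r -> `|a j r| <= M.
  by move=> jk /Ksupp Kr; apply: (Mbound tau) => //; exact: In_nth.
have inta j : (j < k)%N -> (distD Pi).-integrable setT (EFin \o a j).
  move=> jk; apply: (@integrable_bounded_off_null _ _ _ _ K _ M) => //.
    have [_ mupd mwt _] := fork_spec wf tT (In_nth noFork jk).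
    have mv : measurable_fun setT (fun r : SV => (v, r)).
      exact: measurable_fun_pair.
    apply: measurable_funM.
      exact: (measurableT_comp mwt mv).
    apply: measurableT_comp; first exact: measurable_polynomial.
    exact: (measurableT_comp mupd mv).
  by move=> r; exact: aM.
have intG : input_law.-integrable setT
    (fun ur => (weighted_value (step Pi (l, v, w) ur.1 ur.2))%:E).
  apply: (integrable_step (K := K) (M := `|w| * M)) => // u r Kr.
  by rewrite stepE normrM ler_wpM2l// aM.
rewrite -(integral12_prod_meas1 intG) /fubini_F.
pose I j := fine (\int[distD Pi]_r (a j r)%:E).
have IE j : (j < k)%N -> (\int[distD Pi]_r (a j r)%:E = (I j)%:E)%E.
  by move=> jk; rewrite /I fineK//; apply: integrable_fin_num => //; exact: inta.
transitivity (\int[unif01 R]_u (w * I (idx u))%:E)%E.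
  apply: eq_integral => u _ /=.
  under eq_integral do rewrite stepE EFinM.
  by rewrite integralZl ?IE// -?EFinM//; exact: inta.
rewrite (integral_inverse_cdf (fun j => w * I j))//.
rewrite /ewt (negbTE ll) en -/Fs (big_nth noFork) big_mkord -/k.
rewrite (eq_bigr (fun j : 'I_k => (fork_prob Pi Fs j * I j)%:E)); last first.
  by move=> j _; rewrite EFinM -IE.
rewrite sumEFin -EFinM mulr_sumr; congr EFin; apply: eq_bigr => j _.
by rewrite mulrCA.
Qed.

End expected_step.

(** * Runs of a WPTS *)

(** The inequalities on [ewt] are known at reachable states only, and a run is known to be reachable
    only for almost every outcome. *)
Lemma le_integral_off_null d (T : measurableType d) (R : realType)
    (mu : {measure set T -> \bar R}) (K : set T) (f g : T -> \bar R) :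
  measurable K -> mu (~` K) = 0%E -> mu.-integrable setT f ->
  mu.-integrable setT g -> (forall x, K x -> (f x <= g x)%E) ->
  (\int[mu]_x f x <= \int[mu]_x g x)%E.
Proof.
move=> mK K0 intf intg fg; have mCK := measurableC mK.
rewrite (negligible_integral mCK measurableT intf)//.
rewrite (negligible_integral mCK measurableT intg)//.
rewrite setTD setCK; apply: le_integral => //.
- exact: integrableS intf.
- exact: integrableS intg.
- by move=> x; rewrite inE; exact: fg.
Qed.

Section wpts_run.
Context (R : realType) (np nr : nat) (L : finType) (Pi : wpts R np nr L)
  (v_init : np.-tuple R) (d : measure_display) (Om : measurableType d)
  (P : probability Om R) (U : nat -> Om -> R) (S : nat -> Om -> nr.-tuple R)
  (c3 : R) (h : L -> np.-tuple R -> R).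
Hypothesis wf : wf_wpts Pi.
Hypothesis v_init_supp : supp (mu_init Pi) v_init.
Hypothesis driven : driving_inputs Pi P U S.
Hypothesis c3_gt0 : 0 < c3.
Hypothesis wt_bound : forall tau F, List.In tau (trans Pi) ->
  List.In F (t_forks tau) -> forall v r, `|f_wt F v r| <= expR c3.
Hypothesis hpoly : forall l, is_polynomial (h l).
Local Notation PV := (np.-tuple R).
Local Notation SV := (nr.-tuple R).
Local Notation state := (dloc Pi * PV * R)%type.

(** The run with its location retyped in [dloc Pi], which gives states a sigma-algebra. *)
Definition run_state (n : nat) (om : Om) : state := run_at Pi U S v_init om n.

Lemma run_stateS n om :
  run_state n.+1 om = step Pi (run_state n om) (U n om) (S n om).
Proof. by []. Qed.

Lemma driving_inputs_in n k (B : nat -> set R) (C : nat -> set SV) :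
  (forall i, measurable (B i)) -> (forall i, measurable (C i)) ->
  P (inputs_in U S n k B C) =
  (\prod_(n <= i < n + k) (unif01 R (B i) * distD Pi (C i)))%E.
Proof.
case: driven => mU mS lawU lawS indep mB mC.
(* Mutual independence is applied to the indices of both input families over the whole window. *)
pose s : seq (nat + nat) := map inl (index_iota n (n + k)) ++
  map inr (index_iota n (n + k)).
pose A (x : nat + nat) := match x with
  inl i => U i @^-1` B i | inr i => S i @^-1` C i end.
have us : uniq s.
  rewrite cat_uniq !map_inj_uniq ?iota_uniq//=; try by move=> ? ? [].
  by rewrite andbT; apply/hasPn => x /mapP[i _ ->]; apply/mapP => -[].
have inl_s i : (inl i \in s) = (n <= i < n + k)%N.
  rewrite mem_cat mem_map ?mem_index_iota; last by move=> ? ? [].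
  by rewrite orbC; case: mapP => // -[].
have inr_s i : (inr i \in s) = (n <= i < n + k)%N.
  rewrite mem_cat [in X in _ || X]mem_map ?mem_index_iota; last by move=> ? ? [].
  by case: mapP => // -[].
have := indep s A us; rewrite [X in P X](_ : _ = inputs_in U S n k B C); last first.
  apply/seteqP; split=> [om H i ni|om H [] i i_s].
  - by split; [apply: (H (inl i) (etrans (inl_s i) ni))|
      apply: (H (inr i) (etrans (inr_s i) ni))].
  - by case: (H i (etrans (esym (inl_s i)) i_s)).
  - by case: (H i (etrans (esym (inr_s i)) i_s)).
move=> ->; last first.
  by case=> i _; [exists (B i) => //; exact: mB|exists (C i) => //; exact: mC].
rewrite big_cat !big_map big_split /=; congr (_ * _)%E.
- by apply: eq_bigr => i _; rewrite lawU.
- by apply: eq_bigr => i _; rewrite lawS.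
Qed.

Let mU n : measurable_fun setT (U n). Proof. by case: driven. Qed.
Let mS n : measurable_fun setT (S n). Proof. by case: driven. Qed.

Lemma measurable_run_state n : measurable_fun setT (run_state n).
Proof.
by apply: (@measurable_driven _ _ _ _ _ state _ _
  (fun s u r => step Pi s u r : state) (l_init Pi, v_init, 1) _ _ _
  (measurable_step wf) mU mS).
Qed.

Let FX (s : state) : R := weighted_value h s.

(** The state at time [n] is independent of the inputs of step [n], so these integrate out and leave
    the one-step expectation [Phi]. Integrability of [Phi] along the run is kept for later
    comparisons of integrals. *)
Lemma integral_run_stateS n :
  P.-integrable setT (fun om => (FX (run_state n.+1 om))%:E) ->
  let Phi s := (\int[input_law Pi]_ur (FX (step Pi s ur.1 ur.2))%:E)%E in
  P.-integrable setT (fun om => Phi (run_state n om)) /\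
  (\int[P]_om (FX (run_state n.+1 om))%:E = \int[P]_om Phi (run_state n om))%E.
Proof.
move=> intX Phi.
have mUS : measurable_fun setT (fun om => (U n om, S n om)).
  exact: measurable_fun_pair.
pose G (z : state * (R * SV)) := (FX (step Pi z.1 z.2.1 z.2.2))%:E.
have mG : measurable_fun setT G.
  apply/measurable_EFinP.
  exact: (measurableT_comp (measurable_weighted_value hpoly) (measurable_step wf)).
have joint Q : measurable Q ->
    P [set om | Q (run_state n om, (U n om, S n om))] =
    (law P (measurable_run_state n) \x input_law Pi)%E Q.
  exact: (@driven_joint _ _ _ _ _ state _ _ _ P (unif01 R) (distD Pi)
    (fun s u r => step Pi s u r : state) (l_init Pi, v_init, 1) _ _ run_state
    (measurable_step wf) mU mS _ _ driving_inputs_in).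
split.
- exact: (integrable_independent mUS joint mG intX).
- exact: (integral_independent mUS joint mG intX).
Qed.

(** The cap in [inverse_cdf] selects an actual fork for every real [u], so the pathwise facts below
    hold for arbitrary values of the uniform inputs. *)
Lemma step_spec (l : L) (v : PV) (w u : R) (r : SV) : l != l_out Pi ->
  exists tau F, [/\ enabled Pi l v = Some tau, List.In tau (trans Pi),
    List.In F (t_forks tau) &
    step Pi (l, v, w) u r = (f_tgt F, f_upd F v r, w * f_wt F v r)].
Proof.
move=> ll; have [tau en] := enabled_ex wf v ll; have tT := enabled_In en.
have k0 : (0 < size (t_forks tau))%N.
  case: wf => _ _ /(_ tau tT)[_ _ + _] _.
  by case: (t_forks tau) => // /esym/eqP; rewrite big_nil oner_eq0.
pose dflt := Fork (R := R) (np := np) (nr := nr) (l_out Pi) 0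
  (fun v _ => v) (fun _ _ => 0).
pose j := inverse_cdf (fork_prob Pi (t_forks tau)) (size (t_forks tau)) u.
have jk : (j < size (t_forks tau))%N.
  by rewrite /j /inverse_cdf; move: k0; clear; lia.
exists tau, (nth dflt (t_forks tau) j); split=> //; first exact: In_nth.
by rewrite /step (negbTE ll) en choose_forkE (nth_map dflt).
Qed.

Lemma run_absorbed n m om : (n <= m)%N ->
  loc_of (run_state n om) = l_out Pi -> run_state m om = run_state n om.
Proof.
move=> + lo; elim: m => [|m IH]; first by rewrite leqn0 => /eqP ->.
rewrite leq_eqVlt => /predU1P[->//|]; rewrite ltnS => /IH {}IH.
rewrite run_stateS IH.
by move: lo; case: (run_state n om) => [[l v] w]; rewrite /loc_of /= => ->;
  rewrite eqxx.
Qed.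

Lemma run_weight_ge0 n om : 0 <= wt_of (run_state n om).
Proof.
elim: n => [|n]; first by rewrite /wt_of /= ler01.
rewrite run_stateS.
case: (run_state n om) => [[l v] w] w0.
have [lo|ll] := eqVneq l (l_out Pi); first by rewrite /= lo eqxx.
have [tau [F [_ tT FT ->]]] := step_spec v w (U n om) (S n om) ll.
by have [_ _ _ F0] := fork_spec wf tT FT; rewrite mulr_ge0.
Qed.

(** The invariants are carried together because the bounded-update property applies only at a
    reachable state. *)
Lemma run_bounds (kap : R) n om : 0 < kap ->
  (forall l v tau F r i, reachable Pi l v -> enabled Pi l v = Some tau ->
    List.In F (t_forks tau) -> supp (distD Pi) r ->
    `|tnth (f_upd F v r) i - tnth v i| <= kap) ->
  (forall k, supp (distD Pi) (S k om)) ->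
  [/\ reachable Pi (loc_of (run_state n om)) (val_of (run_state n om)),
      forall i, `|tnth (val_of (run_state n om)) i - tnth v_init i| <= n%:R * kap &
      wt_of (run_state n om) <= expR (c3 * n%:R)].
Proof.
move=> kap0 bupd Ssupp; elim: n => [|n].
  split; first exact: reach_init.
  - by move=> i; rewrite /val_of /= subrr normr0 mul0r.
  - by rewrite /wt_of /= mulr0 expR0.
have := run_weight_ge0 n om.
rewrite run_stateS.
case: (run_state n om) => [[l v] w].
rewrite /wt_of /loc_of /val_of => /= w0 [/= lv vb wb].
have [lo|ll] := eqVneq l (l_out Pi).
  (* After termination the state is frozen while the bounds keep growing, as [kap] and [c3] are
     positive. *)
  split => //=.
  - move=> i; apply: le_trans (vb i) _.
    by rewrite ler_wpM2r ?ler_nat// ltW.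
  - by apply: le_trans wb _; rewrite ler_expR ler_wpM2l ?ler_nat// ltW.
have := step_spec v w (U n om) (S n om) ll.
rewrite /= ?(negbTE ll) => -[tau [F [en tT FT ->]]] /=; split.
- exact: (reach_step lv ll en FT).
- move=> i; have := bupd _ _ _ _ _ i lv en FT (Ssupp n); have := vb i.
  have := ler_normD (tnth (f_upd F v (S n om)) i - tnth v i)
    (tnth v i - tnth v_init i).
  by rewrite addrA subrK -natr1 mulrDl mul1r; lra.
- rewrite -natr1 mulrDr mulr1 expRD; apply: ler_pM => //.
    by have [_ _ _] := fork_spec wf tT FT; apply.
  exact: le_trans (ler_norm _) (wt_bound tT FT _ _).
Qed.

Definition terminated_weight n om : R :=
  if loc_of (run_state n om) == l_out Pi then wt_of (run_state n om) else 0.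

Definition running n : set Om := [set om | loc_of (run_state n om) != l_out Pi].

Lemma measurable_running n : measurable (running n).
Proof.
have mloc : measurable_fun setT (fun s : state => s.1.1).
  by apply: (@measurableT_comp _ _ _ _ _ _ fst).
have := measurableT_comp mloc (measurable_run_state n).
move=> /(_ measurableT (~` [set l_out Pi]) I); rewrite setTI.
congr measurable; apply/seteqP; split=> om /=.
- by move=> /eqP.
- by move=> /eqP.
Qed.

Lemma measurable_terminated_weight n : measurable_fun setT (terminated_weight n).
Proof.
have mw : measurable_fun setT (fun om => wt_of (run_state n om)).
  exact: (measurableT_comp (@measurable_snd _ _ _ _) (measurable_run_state n)).
rewrite (_ : terminated_weight n = fun om =>
  wt_of (run_state n om) * \1_(~` running n) om).
  apply: measurable_funM => //; apply: measurable_indic.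
  exact/measurableC/measurable_running.
apply/funext => om; rewrite /terminated_weight indicE.
case: ifPn => lo; first by rewrite mem_set ?mulr1// /running /= lo.
by rewrite memNset ?mulr0// => /(_ lo).
Qed.

(** The output location is absorbing, so being outside it at time [n] means being outside it at all
    earlier times. *)
Lemma prob_T_gtE n : prob_T_gt Pi P U S v_init n = P (running n).
Proof.
congr (P _); apply/seteqP; split=> om /=; first exact.
move=> lo k kn; apply: contra lo => /eqP lk.
by rewrite (run_absorbed kn lk); exact/eqP.
Qed.

Lemma terminated_weight_ge0 n om : 0 <= terminated_weight n om.
Proof. by rewrite /terminated_weight; case: ifP => // _; exact: run_weight_ge0. Qed.

Lemma terminated_weight_homo om :
  {homo terminated_weight^~ om : n m / (n <= m)%N >-> n <= m}.
Proof.
move=> n m nm; rewrite {1}/terminated_weight; case: eqP => [lo|_].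
  by rewrite /terminated_weight (run_absorbed nm lo) lo eqxx.
exact: terminated_weight_ge0.
Qed.

(** Monotone convergence: weights are nonnegative and freeze at termination. On each run the
    sequence is eventually the final weight, or constantly 0 if the run never terminates. *)
Lemma cvg_terminated_weight :
  (\int[P]_om (terminated_weight n om)%:E @[n --> \oo] -->
   expected_weight Pi P U S v_init setT)%E.
Proof.
rewrite (_ : expected_weight _ _ _ _ _ _ =
    \int[P]_om limn (fun n => (terminated_weight n om)%:E))%E.
  apply: cvg_monotone_convergence => //.
  - by move=> n; apply/measurable_EFinP; exact: measurable_terminated_weight.
  - by move=> n om _; rewrite lee_fin terminated_weight_ge0.
  - by move=> om _ n m nm; rewrite lee_fin; exact: terminated_weight_homo.
apply: eq_integral => om _; apply/esym; apply: cvg_lim => //.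
apply: cvg_near_cst; rewrite /term_time; case: pselect => [ex|nex].
- case: ex_minnP => m /eqP lo _; exists m => // n /= mn.
  rewrite /terminated_weight (run_absorbed mn lo) ifT; last exact/eqP.
  by rewrite indicE mem_set ?mul1r.
- exists 0%N => // n _ /=; rewrite /terminated_weight.
  by case: ifP => // lo; exfalso; apply: nex; exists n.
Qed.

End wpts_run.

(** * Martingale inequalities and comparison with the terminated weight *)

Section martingale.
Context (R : realType) (np nr : nat) (L : finType) (Pi : wpts R np nr L)
  (v_init : np.-tuple R) (d : measure_display) (Om : measurableType d)
  (P : probability Om R) (U : nat -> Om -> R) (S : nat -> Om -> nr.-tuple R)
  (c1 c2 c3 : R) (h : L -> np.-tuple R -> R).
Hypothesis wf : wf_wpts Pi.
Hypothesis bu : bounded_update Pi.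
Hypothesis v_init_supp : supp (mu_init Pi) v_init.
Hypothesis driven : driving_inputs Pi P U S.
Hypothesis c1_gt0 : 0 < c1.
Hypothesis c3_gt0 : 0 < c3.
Hypothesis c32 : c3 < c2.
Hypothesis tail : exists N : nat, forall n : nat, (N <= n)%N ->
  (prob_T_gt Pi P U S v_init n <= (c1 * expR (- (c2 * n%:R)))%:E)%E.
Hypothesis wt_bound : forall tau F, List.In tau (trans Pi) ->
  List.In F (t_forks tau) -> forall v r, `|f_wt F v r| <= expR c3.
Hypothesis hpoly : forall l, is_polynomial (h l).
Hypothesis h_out : forall v, reachable Pi (l_out Pi) v -> h (l_out Pi) v = 1.

Local Notation X := (run_state Pi v_init U S).
Local Notation Y := (terminated_weight Pi v_init U S).
Local Notation FX := (weighted_value (Pi := Pi) h).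
Local Notation h0 := (h (l_init Pi) v_init).

Lemma almost_sure_inputs : exists Om0 : set Om,
  [/\ measurable Om0, P (~` Om0) = 0%E &
      forall om, Om0 om -> forall n, supp (distD Pi) (S n om)].
Proof.
have [K [mK K0 Ksupp]] := supp_full (distD Pi).
case: driven => _ mS _ lawS _.
have mSK n B : measurable B -> measurable (S n @^-1` B).
  by move=> mB; rewrite -[X in measurable X]setTI; exact: mS.
exists (\bigcap_n S n @^-1` K); split.
- by apply: bigcap_measurable => // n _; exact: mSK.
- rewrite setC_bigcap; apply: measure_negligible.
    by apply: bigcup_measurable => n _; apply: measurableC; exact: mSK.
  apply: negligible_bigcup => n; apply: (negligibleP P _).2.
    by apply: measurableC; exact: mSK.
  by rewrite preimage_setC [LHS]lawS//; exact: measurableC.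
- by move=> om omK n; apply: Ksupp; exact: omK.
Qed.

Lemma weighted_value_growth : exists C K, 0 <= C /\ forall n om,
  (forall k, supp (distD Pi) (S k om)) ->
  `|FX (X n om)| <= C * n.+1%:R ^+ K * expR (c3 * n%:R).
Proof.
have [kap [kap0 bupd]] := bu.
have [C [K [C0 hCK]]] := polynomial_bound_fin hpoly.
(* Chosen so that [n.+1 * B] is at least 1 and dominates the initial coordinates plus a displacement
   of [n * kap]. *)
pose B := 1 + \sum_i `|tnth v_init i| + kap.
have s0 : 0 <= \sum_i `|tnth v_init i| by exact: sumr_ge0.
have B1 : 1 <= B by rewrite /B; lra.
exists (C * B ^+ K), K; split.
  by rewrite mulr_ge0// exprn_ge0// (le_trans ler01).
move=> n om omS.
have [_ vb wb] := run_bounds U wf v_init_supp c3_gt0 wt_bound n kap0 bupd omS.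
have w0 := run_weight_ge0 v_init U S wf n om.
rewrite /weighted_value normrM mulrC; apply: ler_pM => //; last first.
  by rewrite ger0_norm.
rewrite -mulrA -exprMn; apply: hCK => [|i].
  by rewrite mulr_ege1// ler1n.
have := vb i.
have := ler_normD (tnth (X n om).1.2 i - tnth v_init i) (tnth v_init i).
rewrite subrK /val_of.
have : `|tnth v_init i| <= \sum_i `|tnth v_init i|.
  by rewrite (bigD1 i)//= lerDl sumr_ge0.
rewrite /B -natr1; have : 0 <= n%:R :> R by [].
have := mulr_ge0 (ler0n R n) s0; nra.
Qed.

Lemma integrable_weighted_value n : P.-integrable setT (fun om => (FX (X n om))%:E).
Proof.
have [Om0 [mOm0 Om00 Om0S]] := almost_sure_inputs.
have [C [K [_ CK]]] := weighted_value_growth.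
apply: (@integrable_bounded_off_null _ _ _ _ Om0 _
  (C * n.+1%:R ^+ K * expR (c3 * n%:R))) => //.
- exact: (measurableT_comp (measurable_weighted_value hpoly)
    (measurable_run_state v_init wf driven n)).
- by move=> om /Om0S; exact: CK.
Qed.

Lemma integrable_terminated_weight n : P.-integrable setT (fun om => (Y n om)%:E).
Proof.
have [Om0 [mOm0 Om00 Om0S]] := almost_sure_inputs.
have [kap [kap0 bupd]] := bu.
apply: (@integrable_bounded_off_null _ _ _ _ Om0 _ (expR (c3 * n%:R))) => //.
- exact: measurable_terminated_weight wf driven n.
- move=> om /Om0S omS; rewrite ger0_norm ?terminated_weight_ge0//.
  have [_ _ wb] := run_bounds U wf v_init_supp c3_gt0 wt_bound n kap0 bupd omS.
  by rewrite /terminated_weight; case: ifP => // _; rewrite expR_ge0.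
Qed.

(** Gathers what both directions share: either nothing changes in expectation, or a nonnegative
    weight multiplies [h] before the step and [ewt] after it. *)
Lemma expected_step_run n om : (forall k, supp (distD Pi) (S k om)) ->
  let Phi s := (\int[input_law Pi]_ur (FX (step Pi s ur.1 ur.2))%:E)%E in
  Phi (X n om) = (FX (X n om))%:E \/
  exists l v w, [/\ reachable Pi l v, l != l_out Pi, 0 <= w,
    FX (X n om) = w * h l v & Phi (X n om) = (w%:E * ewt Pi h l v)%E].
Proof.
move=> omS Phi; have [kap [kap0 bupd]] := bu.
have [lv _ _] := run_bounds U wf v_init_supp c3_gt0 wt_bound n kap0 bupd omS.
have := run_weight_ge0 v_init U S wf n om.
move: lv; case: (X n om) => [[l v] w] /= lv w0.
have [lo|ll] := eqVneq l (l_out Pi).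
  by left; exact: expected_step_out.
right; exists l, v, w; split => //; exact: (expected_step wf bu wt_bound hpoly).
Qed.

Lemma expectation_weighted_value0 : (\int[P]_om (FX (X 0 om))%:E = h0%:E)%E.
Proof.
rewrite (eq_integral (fun=> h0%:E)).
  by rewrite integral_cst// [X in (_ * X)%E](probability_setT P) mule1.
by move=> om _; rewrite /weighted_value /= mul1r.
Qed.

(** After the inputs of step [n] are integrated out, the inequality on [ewt], scaled by the
    nonnegative weight, compares the integrands on an event of full measure. *)
Lemma supermartingale n :
  (forall l v, reachable Pi l v -> l != l_out Pi ->
    (ewt Pi h l v <= (h l v)%:E)%E) ->
  (\int[P]_om (FX (X n om))%:E <= h0%:E)%E.
Proof.
move=> C1; elim: n => [|n IH]; first by rewrite expectation_weighted_value0.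
have [Om0 [mOm0 Om00 Om0S]] := almost_sure_inputs.
have [intPhi ->] :=
  integral_run_stateS wf driven hpoly (integrable_weighted_value n.+1).
apply: le_trans IH; apply: (le_integral_off_null mOm0 Om00) => //.
  exact: integrable_weighted_value.
move=> om /Om0S omS.
have [->//|[l [v [w [lv ll w0 -> ->]]]]] := expected_step_run n omS.
by rewrite EFinM lee_wpmul2l//; exact: C1.
Qed.

Lemma submartingale n :
  (forall l v, reachable Pi l v -> l != l_out Pi ->
    ((h l v)%:E <= ewt Pi h l v)%E) ->
  (h0%:E <= \int[P]_om (FX (X n om))%:E)%E.
Proof.
move=> C1; elim: n => [|n IH]; first by rewrite expectation_weighted_value0.
have [Om0 [mOm0 Om00 Om0S]] := almost_sure_inputs.
have [intPhi ->] :=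
  integral_run_stateS wf driven hpoly (integrable_weighted_value n.+1).
apply: (le_trans IH); apply: (le_integral_off_null mOm0 Om00) => //.
  exact: integrable_weighted_value.
move=> om /Om0S omS.
have [->//|[l [v [w [lv ll w0 -> ->]]]]] := expected_step_run n omS.
by rewrite EFinM lee_wpmul2l//; exact: C1.
Qed.

(** On terminated runs [h] equals 1 and the two integrands coincide; on the others the terminated
    weight is 0 and the gap is at most [M]. The expected gap is thus at most [M] times the tail
    probability, of exponential rate [c2 - c3] up to a polynomial factor. *)
Lemma terminated_weight_approx (eps : R) : 0 < eps ->
  exists N, forall n, (N <= n)%N ->
    (\int[P]_om (Y n om)%:E <= \int[P]_om (FX (X n om))%:E + eps%:E)%E /\
    (\int[P]_om (FX (X n om))%:E <= \int[P]_om (Y n om)%:E + eps%:E)%E.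
Proof.
move=> e0; have [Om0 [mOm0 Om00 Om0S]] := almost_sure_inputs.
have [kap [kap0 bupd]] := bu.
have [C [K [C0 CK]]] := weighted_value_growth.
have [N1 tailN] := tail.
have [N2 decay] : exists N, forall n, (N <= n)%N ->
    c1 * C * n.+1%:R ^+ K * expR (- ((c2 - c3) * n%:R)) <= eps.
  by apply: exp_decay_beats_pow; rewrite ?subr_gt0// mulr_ge0// ltW.
exists (maxn N1 N2) => n; rewrite geq_max => /andP[Nn1 Nn2].
pose M := C * n.+1%:R ^+ K * expR (c3 * n%:R).
have M0 : 0 <= M by rewrite !mulr_ge0 ?exprn_ge0 ?expR_ge0.
pose T := running Pi v_init U S n.
have mT : measurable T by exact: measurable_running wf driven n.
have intT : P.-integrable setT (fun om => (M * \1_T om)%:E).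
  apply: (integrableZl measurableT M (f := EFin \o \1_T)).
  by apply/integrable_indic.
have MT : (\int[P]_om (M * \1_T om)%:E <= eps%:E)%E.
  under eq_integral do rewrite EFinM.
  rewrite integralZl//; last exact: integrable_indic.
  rewrite integral_indic// setIT.
  apply: (@le_trans _ _ (M%:E * (c1 * expR (- (c2 * n%:R)))%:E)%E).
    by apply: lee_wpmul2l => //; have := tailN n Nn1; rewrite prob_T_gtE.
  rewrite -EFinM lee_fin; apply: le_trans (decay n Nn2).
  rewrite le_eqVlt; apply/orP; left; apply/eqP.
  have -> : - ((c2 - c3) * n%:R) = c3 * n%:R - c2 * n%:R by ring.
  by rewrite /M expRD; ring.
have close om : Om0 om -> `|FX (X n om) - Y n om| <= M * \1_T om.
  move=> /Om0S omS; have := CK n om omS; rewrite -/M.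
  have [lv _ _] := run_bounds U wf v_init_supp c3_gt0 wt_bound n kap0 bupd omS.
  rewrite /terminated_weight indicE; case: ifPn => lo.
    move=> _; rewrite memNset; last by move=> /negP; apply.
    move: lv lo; rewrite /weighted_value /loc_of /val_of /wt_of.
    case: (X n om) => [[l v] w] /= lv /eqP lo.
    by rewrite lo in lv *; rewrite h_out// mulr1 subrr normr0 mulr0.
  by rewrite mem_set// mulr1 subr0.
have intX := integrable_weighted_value n.
have intY := integrable_terminated_weight n.
split.
- apply: (@le_trans _ _ (\int[P]_om ((FX (X n om))%:E + (M * \1_T om)%:E))%E).
    apply: (le_integral_off_null mOm0 Om00) => //; first exact: integrableD.
    move=> om /close; rewrite ler_norml -EFinD lee_fin => /andP[+ _]; lra.
  by rewrite integralD//; apply: leeD.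
- apply: (@le_trans _ _ (\int[P]_om ((Y n om)%:E + (M * \1_T om)%:E))%E).
    apply: (le_integral_off_null mOm0 Om00) => //; first exact: integrableD.
    move=> om /close; rewrite ler_norml -EFinD lee_fin => /andP[_ +]; lra.
  by rewrite integralD//; apply: leeD.
Qed.

End martingale.

Theorem theorem4p4 (R : realType) (np nr : nat) (L : finType)
  (Pi : wpts R np nr L) (v_init : np.-tuple R)
  (d : measure_display) (Om : measurableType d) (P : probability Om R)
  (U : nat -> Om -> R) (S : nat -> Om -> nr.-tuple R)
  (c1 c2 c3 : R) (h : L -> np.-tuple R -> R) :
  wf_wpts Pi ->
  bounded_update Pi ->
  supp (mu_init Pi) v_init ->
  driving_inputs Pi P U S ->
  0 < c1 -> 0 < c3 -> c3 < c2 ->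
  (* (E1) *)
  (exists N : nat, forall n : nat, (N <= n)%N ->
     (prob_T_gt Pi P U S v_init n <= (c1 * expR (- (c2 * n%:R)))%:E)%E) ->
  (* (E2) *)
  (forall tau F, List.In tau (trans Pi) -> List.In F (t_forks tau) ->
     forall v r, `|f_wt F v r| <= expR c3) ->
  (forall l, is_polynomial (h l)) ->
  (PUWF Pi h ->
     (expected_weight Pi P U S v_init setT <= (h (l_init Pi) v_init)%:E)%E) /\
  (PLWF Pi h ->
     ((h (l_init Pi) v_init)%:E <= expected_weight Pi P U S v_init setT)%E).
Proof.
move=> wf bu v_supp driven c1_gt0 c3_gt0 c32 tail wt_bound hpoly.
have cvgY := cvg_terminated_weight (v_init := v_init) wf driven.
(* Each bound is proved up to an arbitrary [e]: the expected terminated weights converge to the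
   expected weight and are eventually within [e] of the expected weighted values. *)
split=> -[C1 C2]; apply/lee_addgt0Pr => e e0;
  have [N approx] := terminated_weight_approx wf bu v_supp driven c1_gt0 c3_gt0
    c32 tail wt_bound hpoly C2 e0.
- apply: (cvge_to_le cvgY); exists N => // n /= Nn.
  apply: le_trans (approx n Nn).1 _; rewrite leeD2r//.
  exact: (supermartingale wf bu v_supp driven c3_gt0 wt_bound hpoly).
(* Moving [e] to the left makes the lower bound independent of [n], so it passes to the limit. *)
- rewrite -leeBlDr//; apply: (cvge_to_ge cvgY); exists N => // n Nn.
  rewrite leeBlDr//; apply: le_trans (approx n Nn).2.
  exact: (submartingale wf bu v_supp driven c3_gt0 wt_bound hpoly).
Qed.
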